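(* Let $K\subset\mathbb{R}^n$ be a convex body and $j\in\{0,\ldots,n\}$. There exist a $j$-dimensional linear subspace $U^\ast\subset\mathbb{R}^n$ and a point $x^\ast\in K$ such that $$K-x^\ast\subset \alpha_j(K)\,\Phi_{U^\ast}(K-x^\ast).$$ Moreover, the map $\alpha_j:\mathcal{K}^n\to\mathbb{R}$ is continuous with respect to the Hausdorff distance on $\mathcal{K}^n$.
   Context: $\mathcal{K}^n$ is the family of convex bodies in $\mathbb{R}^n$, i.e. compact convex sets with nonempty interior. For an affine subspace $U\subset\mathbb{R}^n$, $P_U$ is the orthogonal projection onto $U$ and $\Phi_U(x)=2P_U(x)-x$ is the reflection across $U$. For $K,C\in\mathcal{K}^n$, $R(K,C)=\inf\{\lambda>0 : K\subset z+\lambda C\text{ for some }z\in\mathbb{R}^n\}$. The $j$th Minkowski chirality is $\alpha_j(K)=\inf\{R(K,\Phi_U(K)) : U\subset\mathbb{R}^n\text{ affine subspace},\ \dim U=j\}$ (equivalently, the infimum may be taken over $j$-dimensional linear subspaces). The Hausdorff distance is $d_H(K,L)=\inf\{\lambda>0 : K\subset L+\lambda B,\ L\subset K+\lambda B\}$ with $B$ the closed Euclidean unit ball. *)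

(* Defs.v *)
From mathcomp Require Import all_boot all_order all_algebra.
From mathcomp Require Import all_classical all_reals all_analysis.

Set Implicit Arguments.
Unset Strict Implicit.
Unset Printing Implicit Defensive.

Import Order.TTheory GRing.Theory Num.Theory.
Import numFieldNormedType.Exports.

Local Open Scope classical_set_scope.
Local Open Scope ring_scope.

(* R^n is 'rV[R]_n.  The norm `|_| of the library on 'rV[R]_n is the sup norm;
   it is used only through the topology it induces, which is the usual one.
   All metric notions below go through the Euclidean inner product. *)
Definition dotv (R : realType) (n : nat) (u v : 'rV[R]_n) : R :=
  \sum_(i < n) u 0 i * v 0 i.

Definition enorm (R : realType) (n : nat) (u : 'rV[R]_n) : R :=
  Num.sqrt (dotv u u).

Definition eball (R : realType) (n : nat) : set 'rV[R]_n :=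
  [set b | enorm b <= 1].

Definition convex_body (R : realType) (n : nat) (K : set 'rV[R]_n) : Prop :=
  [/\ compact K, convex_set K & K° !=set0].

Definition affine_subspace (R : realType) (n j : nat) (U : set 'rV[R]_n) : Prop :=
  exists (p : 'rV[R]_n) (V : {vspace 'rV[R]_n}),
    \dim V = j /\ U = [set p + v | v in [set` V]].

(* The default value 0 of xget is never reached when U is an affine subspace:
   the foot of the perpendicular from x to U exists and is unique. *)
Definition oproj (R : realType) (n : nat) (U : set 'rV[R]_n) (x : 'rV[R]_n) :
    'rV[R]_n :=
  xget 0 [set p | U p /\ forall u, U u -> dotv (x - p) (u - p) = 0].

Definition reflection (R : realType) (n : nat) (U : set 'rV[R]_n)
    (x : 'rV[R]_n) : 'rV[R]_n :=
  2 *: oproj U x - x.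

Definition containment_factor (R : realType) (n : nat) (K C : set 'rV[R]_n) : R :=
  inf [set l : R | 0 < l /\
    exists z : 'rV[R]_n, K `<=` [set z + l *: c | c in C]].

Definition chirality (R : realType) (n j : nat) (K : set 'rV[R]_n) : R :=
  inf [set containment_factor K (reflection U @` K) |
       U in [set U | affine_subspace j U]].

Definition hausdorff_dist (R : realType) (n : nat) (K L : set 'rV[R]_n) : R :=
  inf [set l : R | [/\ 0 < l,
    K `<=` [set y + l *: b | y in L & b in @eball R n] &
    L `<=` [set y + l *: b | y in K & b in @eball R n]]].

(* Main.v *)
(* Write a j-dimensional reflection as the matrix M = 2P - 1 with P a symmetric
   idempotent of trace j.  If l > 0, then K is contained in a translate of
   l Phi(K) iff for m = 1/l some map y |-> z + m y M sends K into itself.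
   Such an affine self-map of the compact convex set K has a fixed point x in K,
   so it reads y |-> x + m (y - x) M; the triples (P, x, m) arising in this way
   form a compact set, on which m is maximal at m = 1 / alpha_j(K).
   For continuity, if K contains x0 + r B and d_H(K, L) < t r with t < 1, then
   (1 - t)(K - x0) <= L - x0 <= (1 + t)(K - x0), the left inclusion by
   cancellation of t (K - x0); hence alpha_j(K) and alpha_j(L) differ by a
   factor at most (1 + t) / (1 - t). *)
Require Import Defs.
From mathcomp Require Import all_boot all_order all_algebra.
From mathcomp Require Import all_classical all_reals all_analysis.
From mathcomp Require Import ring lra.

Set Implicit Arguments.
Unset Strict Implicit.
Unset Printing Implicit Defensive.

Import Order.TTheory GRing.Theory Num.Theory.
Import numFieldNormedType.Exports.

Local Open Scope classical_set_scope.
Local Open Scope ring_scope.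

(** * Continuity and compactness for spaces of matrices *)

Section MatrixTopology.
Variables (R : realType) (T : topologicalType).

Lemma continuous_mx m n (f : T -> 'M[R]_(m, n)) :
  (forall i j, continuous (fun x => f x i j)) -> continuous f.
Proof.
move=> fc x B [P Pn PB].
rewrite /nbhs/=; apply: (@filterS _ (nbhs x) _ _ _ (fun y H => PB _ H)).
apply: filter_forall => i; apply: filter_forall => j.
exact: (fc i j x _ (Pn i j)).
Qed.

Lemma continuous_entry m n (f : T -> 'M[R]_(m, n)) i j : continuous f ->
  continuous (fun x => f x i j).
Proof.
move=> fc x.
exact: (continuous_comp (fc x) (@coord_continuous _ _ _ i j (f x))).
Qed.

Lemma continuous_mulmx m p n (f : T -> 'M[R]_(m, p)) (g : T -> 'M[R]_(p, n)) :
  continuous f -> continuous g -> continuous (fun x => f x *m g x).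
Proof.
move=> fc gc; apply: continuous_mx => i j.
rewrite (_ : (fun x => _) = fun x => \sum_k (f x i k * g x k j : R^o)); last first.
  by apply/funext => x; rewrite mxE.
apply: continuous_big; first exact: add_continuous.
by move=> k _ x; apply: continuousM; apply: continuous_entry.
Qed.

End MatrixTopology.

(** Flattening by [vec_mx] reduces this to a product of segments in a space of row vectors. *)
Lemma compact_mx_box (R : realType) m n (c : R) :
  compact [set A : 'M[R]_(m, n) | forall i j, `|A i j| <= c].
Proof.
have -> : [set A : 'M[R]_(m, n) | forall i j, `|A i j| <= c] =
    vec_mx @` [set v : 'rV[R]_(m * n) | forall k, `[- c, c]%classic (v ord0 k)].
  apply/seteqP; split=> [A Ac | _ [v vc <-] i j].
    exists (mxvec A); last by rewrite mxvecK.
    move=> k; case/mxvec_indexP: k => i j.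
    by rewrite mxvecE /= in_itv/= -ler_norml.
  by rewrite mxE ler_norml; have := vc (mxvec_index i j); rewrite /= in_itv.
apply: continuous_compact; last by
  apply: (@rV_compact _ _ (fun=> `[- c, c]%classic)) => k; apply: segment_compact.
apply: continuous_subspaceT; apply: continuous_mx => i j.
by under eq_fun do rewrite mxE; exact: coord_continuous.
Qed.

(** * Averaging arguments in compact convex sets *)

Section Convexity.
Variables (R : realType) (n : nat).
Implicit Types (K : set 'rV[R]_n) (x y z : 'rV[R]_n) (A : 'M[R]_n).

Lemma convex_setE K x y t : convex_set K -> 0 <= t <= 1 -> K x -> K y ->
  K (t *: x + (1 - t) *: y).
Proof.
move=> cK /andP[t0 t1] Kx Ky.
have /set_mem := cK x y (Itv01 t0 t1) (mem_set Kx) (mem_set Ky).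
by [].
Qed.

Lemma convex_set_avg K (u : nat -> 'rV[R]_n) N : convex_set K ->
  (forall i, K (u i)) -> K (N.+1%:R^-1 *: \sum_(i < N.+1) u i).
Proof.
move=> cK Ku; elim: N => [|N IH]; first by rewrite big_ord1 invr1 scale1r.
rewrite big_ord_recr /= scalerDr.
set s := \sum_(i < N.+1) _ in IH *.
have N1 : N.+1%:R != 0 :> R by rewrite pnatr_eq0.
have N2 : N.+2%:R != 0 :> R by rewrite pnatr_eq0.
(* The average of [N+2] points is a convex combination of the average of the first [N+1] and the
   last point, which has weight [1/(N+2)]. *)
have -> : N.+2%:R^-1 *: s = (1 - N.+2%:R^-1) *: (N.+1%:R^-1 *: s).
  rewrite scalerA; congr (_ *: s).
  apply: (mulfI N2); rewrite mulrA mulrBr mulr1 divff// -[N.+2]addn1 natrD.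
  by rewrite addrK divff// -natrD addn1.
rewrite addrC; apply: convex_setE => //.
by rewrite invr_ge0 ler0n/= invf_le1 ?ler1n ?ltr0n.
Qed.

Lemma compact_normP K : compact K ->
  exists2 M : R, 0 < M & forall x, K x -> `|x| <= M.
Proof.
move=> /compact_bounded[M [Mreal KM]]; exists (`|M| + 1).
  by rewrite ltr_wpDl.
by move=> x Kx; apply: KM Kx; rewrite (le_lt_trans (ler_norm M))// ltrDl.
Qed.

Lemma closed_approx K x : closed K ->
  (forall e : R, 0 < e -> exists2 y, K y & `|x - y| < e) -> K x.
Proof.
move=> clK xK; apply: clK => B /nbhs_ballP[e /= e0 eB].
by have [y Ky xy] := xK e e0; exists y; split=> //; apply: eB; rewrite -ball_normE.
Qed.

Lemma avg_small (M e : R) : 0 < M -> 0 < e -> exists N, N.+1%:R^-1 * M < e.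
Proof.
move=> M0 e0; exists (Num.truncn (M / e)).
by rewrite mulrC ltr_pdivrMr ?ltr0n// mulrC -ltr_pdivrMr// truncnS_gt.
Qed.

(* The displacement of the average of the first [N] iterates is
   [(T^N x - x) / N], so the minimal displacement on [K] vanishes. *)
Lemma affine_fixpoint K z A : compact K -> convex_set K -> K !=set0 ->
  (forall y, K y -> K (z + y *m A)) -> exists2 x, K x & x = z + x *m A.
Proof.
move=> coK cK [y0 Ky0] KT.
pose T y : 'rV[R]_n := z + y *m A.
have contT : continuous (fun y => `|T y - y|).
  move=> y; apply: continuous_comp; last exact: norm_continuous.
  apply: continuousB; last exact: cvg_id.
  apply: continuousD; first exact: cst_continuous.
  apply: continuous_mulmx => x; first exact: cvg_id.
  exact: cst_continuous.
have [x /set_mem Kx xmin] : exists2 c, c \in K &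
    forall t, t \in K -> `|T c - c| <= `|T t - t|.
  apply: compact_EVT_min => //; first by exists y0.
  exact: continuous_subspaceT.
exists x => //; apply/eqP; rewrite -subr_eq0 -normr_eq0 -/(T x) distrC.
have [M M0 KM] := compact_normP coK.
pose c i := iter i T y0.
have Kc i : K (c i) by elim: i => //= i; exact: KT.
apply/eqP/le_anti; rewrite normr_ge0 andbT; apply/ler_addgt0Pl => e e0.
rewrite addr0.
have [N Ne] := avg_small (addr_gt0 M0 M0) e0.
apply: le_trans (ltW Ne).
pose a := N.+1%:R^-1 *: \sum_(i < N.+1) c i.
have N1 : N.+1%:R != 0 :> R by rewrite pnatr_eq0.
have Ta : T a = N.+1%:R^-1 *: \sum_(i < N.+1) c i.+1.
  rewrite /c /= {2}/T big_split /= sumr_const card_ord -[z *+ _]scaler_nat.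
  by rewrite scalerDr scalerA mulVf// scale1r -mulmx_suml scalemxAl.
have {}Ta : T a - a = N.+1%:R^-1 *: (c N.+1 - c 0%N).
  rewrite Ta -scalerBr -sumrB -(telescope_sumr c (leq0n N.+1)).
  by rewrite big_mkord.
apply: le_trans (xmin a _) _; first by apply/mem_set; exact: convex_set_avg.
rewrite Ta normrZ ger0_norm// ler_wpM2l//.
by rewrite (le_trans (ler_normB _ _))// lerD// KM.
Qed.

(* Iterating [a + c_i = b_i + c_(i+1)] and averaging exhibits [a] as a limit
   of averages of the [b_i]. *)
Lemma set_cancel (B C : set 'rV[R]_n) a : closed B -> convex_set B ->
  compact C -> C !=set0 ->
  (forall c, C c -> exists b c', [/\ B b, C c' & a + c = b + c']) -> B a.
Proof.
move=> clB cB coC [c0 Cc0] step.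
have /choice[f Hf] : forall c, exists bc : 'rV[R]_n * 'rV[R]_n,
    C c -> [/\ B bc.1, C bc.2 & a + c = bc.1 + bc.2].
  move=> c; have [/step[b [c' H]]|nC] := pselect (C c); first by exists (b, c').
  by exists (0, 0).
pose c i := iter i (fun c => (f c).2) c0.
have Cc i : C (c i) by elim: i => //= i /Hf[].
have [M M0 CM] := compact_normP coC.
apply: (closed_approx clB) => e e0.
have [N Ne] := avg_small (addr_gt0 M0 M0) e0.
exists (N.+1%:R^-1 *: \sum_(i < N.+1) (f (c i)).1).
  apply: (convex_set_avg (u := fun i => (f (c i)).1)) => // i.
  by case: (Hf _ (Cc i)).
have N1 : N.+1%:R != 0 :> R by rewrite pnatr_eq0.
have -> : a - N.+1%:R^-1 *: \sum_(i < N.+1) (f (c i)).1 =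
    N.+1%:R^-1 *: (c N.+1 - c 0%N).
  apply: (scalerI N1); rewrite scalerBr !scalerA divff// !scale1r.
  rewrite -(telescope_sumr c (leq0n N.+1)) big_mkord scaler_nat.
  rewrite -[X in a *+ X](card_ord N.+1) -sumr_const -sumrB.
  apply: eq_bigr => i _; have [_ _ E] := Hf _ (Cc i).
  by apply/eqP; rewrite subr_eq addrAC eq_sym subr_eq E addrC.
rewrite normrZ ger0_norm//; apply: le_lt_trans Ne.
by rewrite ler_wpM2l// (le_trans (ler_normB _ _))// lerD// CM.
Qed.

End Convexity.

(** * Reflections as matrices, and chirality as an infimum over affine self-maps *)

Section Reflections.
Variables (R : realType) (n : nat).
Implicit Types (P : 'M[R]_n) (x y z u v w : 'rV[R]_n) (V : {vspace 'rV[R]_n}).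

Lemma dotvE u v : dotv u v = (u *m v^T) 0 0.
Proof. by rewrite mxE; apply: eq_bigr => i _; rewrite mxE. Qed.

Lemma dotvv_eq0 u : dotv u u = 0 -> u = 0.
Proof.
move=> /eqP; rewrite psumr_eq0 => [/allP u0|i _]; last by rewrite -expr2 sqr_ge0.
apply/rowP => i; rewrite mxE; have := u0 i (mem_index_enum i).
by rewrite mulf_eq0 orbb => /eqP.
Qed.

(** The orthogonal projections onto [j]-dimensional subspaces, acting on row vectors from the right.
    Fixing the trace instead of the rank makes all three conditions polynomial equations, so the set
    is visibly closed. *)
Definition orthoproj j : set 'M[R]_n :=
  [set P | [/\ P^T = P, P *m P = P & \tr P = j%:R]].

Definition reflmx P : 'M[R]_n := 2 *: P - 1%:M.

Lemma reflmxK j P : orthoproj j P -> reflmx P *m reflmx P = 1%:M.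
Proof.
case=> _ PP _; rewrite /reflmx mulmxBl !mulmxBr -!scalemxAl -!scalemxAr PP.
rewrite mulmx1 !mul1mx {1}[2](mulr2n 1) scalerDl scale1r addrK.
by rewrite opprB addrC subrK.
Qed.

(** With a basis of [V] as the rows of [B], the projection is [B^T (B B^T)^-1 B]. *)
Lemma orthoproj_vspace V : exists P,
  orthoproj (\dim V) P /\ forall x, (x \in V) = (x *m P == x).
Proof.
pose B : 'M[R]_(\dim V, n) := \matrix_i (vbasis V)`_i.
have memV x : x \in V <-> exists c, x = c *m B.
  split=> [Vx|[c ->]].
    exists (\row_i coord (vbasis V) i x).
    rewrite mulmx_sum_row {1}(coord_vbasis Vx); apply: eq_bigr => i _.
    by rewrite mxE rowK.
  rewrite mulmx_sum_row; apply: memv_suml => i _; rewrite rowK memvZ//.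
  by rewrite vbasis_mem// mem_nth ?size_tuple.
have freeB (c : 'rV_(\dim V)) : c *m B = 0 -> c = 0.
  rewrite mulmx_sum_row => cB.
  have /freeP fV := basis_free (vbasisP V).
  apply/rowP => i; rewrite mxE; apply: fV; rewrite -[RHS]cB.
  by apply: eq_bigr => k _; rewrite rowK.
pose G := B *m B^T.
(* The Gram matrix is invertible: [v B B^T = 0] forces [v B] to have squared length 0, and the rows
   of [B] are free. *)
have Gu : G \in unitmx.
  rewrite -row_free_unit -kermx_eq0; apply/rowV0P => v /sub_kermxP vG.
  apply: freeB; apply: dotvv_eq0.
  by rewrite dotvE trmx_mul mulmxA -(mulmxA v) vG mul0mx mxE.
have GT : G^T = G by rewrite /G trmx_mul trmxK.
pose P := B^T *m invmx G *m B.
have BP : B *m P = B by rewrite /P !mulmxA -/G mulmxV// mul1mx.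
exists P; split; first split.
- by rewrite /P !trmx_mul trmxK trmx_inv GT mulmxA.
- by rewrite {1}/P -mulmxA BP.
- by rewrite /P mxtrace_mulC mulmxA mulmxV// mxtrace1.
move=> x; apply/idP/eqP => [/memV[c ->]|xP]; first by rewrite -mulmxA BP.
by apply/memV; exists (x *m B^T *m invmx G); rewrite -{1}xP /P !mulmxA.
Qed.

Lemma oproj_affine V P j p x : orthoproj j P ->
  (forall x, (x \in V) = (x *m P == x)) ->
  oproj [set p + v | v in [set` V]] x = p + (x - p) *m P.
Proof.
move=> [PT PP _] memV; rewrite /oproj.
have VP y : y *m P \in V by rewrite memV -mulmxA PP.
have orth y v : v \in V -> dotv (y - y *m P) v = 0.
  rewrite memV => /eqP <-; rewrite dotvE trmx_mul PT mulmxA mulmxBl.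
  by rewrite -mulmxA PP subrr mul0mx mxE.
apply: xget_unique => [|q [[v Vv <-{q}] vorth]].
  split=> [|_ [v Vv <-]]; first by exists ((x - p) *m P) => //; exact: VP.
  rewrite !opprD !addrA [p + v]addrC addrK; apply: orth.
  by rewrite rpredB// VP.
(* Uniqueness of the foot: for two feet [p + v] and [p + y], adding the two orthogonality relations
   tested on their difference gives squared length 0 for [v - y]. *)
congr (p + _); apply/eqP; rewrite -subr_eq0; apply/eqP/dotvv_eq0.
set y := (x - p) *m P.
have H1 := orth (x - p) (v - y) (rpredB Vv (VP _)); rewrite -/y in H1.
have H2 := vorth (p + y) (ex_intro2 _ _ y (VP _) erefl).
rewrite !opprD !addrA [p + y]addrC addrK in H2.
suff -> : dotv (v - y) (v - y) = dotv (x - p - y) (v - y) + dotv (x - p - v) (y - v).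
  by rewrite H1 H2 addr0.
have {1}-> : v - y = (x - p - y) - (x - p - v) by rewrite opprB [RHS]addrC addrA subrK.
by rewrite -[y - v]opprB !dotvE mulmxBl linearN mulmxN !mxE.
Qed.


(** The offset [w] will be absorbed by the free translation in the containment factor, so affine and
    linear subspaces give the same infimum. *)
Lemma reflection_affine U j : affine_subspace j U ->
  exists P w, orthoproj j P /\ forall x, reflection U x = w + x *m reflmx P.
Proof.
move=> [p [V [<- ->]]]; have [P [oP memV]] := orthoproj_vspace V.
exists P, (2 *: (p - p *m P)); split=> // x.
rewrite /reflection (oproj_affine p x oP memV) /reflmx mulmxBr mulmx1.
by rewrite -scalemxAr addrA -scalerDr mulmxBl addrA addrAC.
Qed.

Lemma orthoproj_subspace P j : orthoproj j P ->
  exists V, \dim V = j /\ forall x, reflection [set` V] x = x *m reflmx P.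
Proof.
move=> oP; have [PT PP trP] := oP.
pose V : {vspace 'rV[R]_n} := limg (linfun (mulmxr P)).
have memV x : (x \in V) = (x *m P == x).
  apply/memv_imgP/eqP => [[y _ ->]|<-]; last by exists x; rewrite ?memvf ?lfunE.
  by rewrite lfunE /= -mulmxA PP.
(* [Q] is the projection built from a basis of the image of [P]. Equal images give [QP = Q] and
   [PQ = P]; transposing the former yields [Q = P], and then the trace of [P] is the dimension. *)
have [Q [[QT QQ trQ] memQ]] := orthoproj_vspace V.
have QP : Q *m P = Q.
  apply/row_matrixP => i; rewrite row_mul; apply/eqP.
  by rewrite -memV memQ -row_mul QQ.
have PQ : P *m Q = P.
  apply/row_matrixP => i; rewrite row_mul; apply/eqP.
  by rewrite -memQ memV -row_mul PP.
have QeqP : Q = P by rewrite -PQ -{1}QT -{1}QP trmx_mul PT QT.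
exists V; split.
  by apply/eqP; rewrite -(eqr_nat R) -trQ QeqP trP.
move=> x; rewrite /reflection.
have -> : [set` V] = [set 0 + v | v in [set` V]].
  by apply/seteqP; split=> [v Vv|_ [v Vv <-]]; rewrite ?add0r//; exists v; rewrite ?add0r.
by rewrite (oproj_affine 0 x oP memV) add0r subr0 /reflmx mulmxBr mulmx1 -scalemxAr.
Qed.

Lemma exists_affine_subspace j : (j <= n)%N ->
  exists U : set 'rV[R]_n, affine_subspace j U.
Proof.
move=> jn; pose X := take j (vbasis {:'rV[R]_n}).
have fX : free X.
  apply: (@catl_free _ _ (drop j (vbasis {:'rV[R]_n}))).
  by rewrite cat_take_drop; exact: basis_free (vbasisP _).
exists [set 0 + v | v in [set` <<X>>%VS]], 0, <<X>>%VS; split=> //.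
move: fX; rewrite /free => /eqP ->.
by rewrite size_takel ?size_tuple ?dimvf ?dim_matrix ?mul1r.
Qed.

Definition selfmap (K : set 'rV[R]_n) P (m : R) :=
  exists z, forall y, K y -> K (z + m *: (y *m reflmx P)).

(** Because the reflection matrix is an involution, [y = z + l (w + c M)] can be solved for [c],
    which is [y M / l] up to a translation. *)
Lemma reflection_containment (K U : set 'rV[R]_n) j P w (l : R) :
  orthoproj j P -> (forall x, reflection U x = w + x *m reflmx P) -> 0 < l ->
  (exists z, K `<=` [set z + l *: c | c in reflection U @` K]) <->
  selfmap K P l^-1.
Proof.
move=> oP rU l0; have l1 : l != 0 by rewrite gt_eqF.
have MM := reflmxK oP; split=> [[z Kz]|[z Kz]].
  exists (- (l^-1 *: z + w) *m reflmx P) => y /Kz[_ [c Kc <-] <-].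
  rewrite rU scalemxAl -mulmxDl scalerDr scalerA mulVf// scale1r.
  by rewrite opprD addrACA addNr add0r addrA addNr add0r -mulmxA MM mulmx1.
exists (- (l *: (w + z *m reflmx P))) => y Ky; have Kc := Kz y Ky.
exists (reflection U (z + l^-1 *: (y *m reflmx P)));
  first by exists (z + l^-1 *: (y *m reflmx P)).
rewrite rU mulmxDl -scalemxAl -mulmxA MM mulmx1 addrA -scalerN -scalerDr addrA.
by rewrite addNr add0r scalerA divff// scale1r.
Qed.

Lemma inf_ge0 (E : set R) : (forall e, E e -> 0 <= e) -> 0 <= inf E.
Proof.
(* The empty set is treated apart: its [inf] takes the default value 0. *)
move=> E0; have [->|/set0P En] := eqVneq E set0; first by rewrite inf0.
exact: lb_le_inf.
Qed.

Lemma containment_factor_ge0 (K C : set 'rV[R]_n) : 0 <= containment_factor K C.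
Proof. by apply: inf_ge0 => l [/ltW]. Qed.

Lemma chirality_ge0 j (K : set 'rV[R]_n) : 0 <= chirality j K.
Proof. by apply: inf_ge0 => _ [U _ <-]; exact: containment_factor_ge0. Qed.

(** Together with [chirality_lt] this identifies the chirality with the infimum of [1/m] over the
    admissible pairs [(P, m)]; the image of [P] is the competing subspace. *)
Lemma chirality_le j (K : set 'rV[R]_n) P m :
  orthoproj j P -> 0 < m -> selfmap K P m -> chirality j K <= m^-1.
Proof.
move=> oP m0 Km; have [V [dimV rV]] := orthoproj_subspace oP.
apply: (@le_trans _ _ (containment_factor K (reflection [set` V] @` K))).
  apply: ge_inf; first by exists 0 => _ [U _ <-]; exact: containment_factor_ge0.
  exists [set` V] => //; exists 0, V; split=> //.
  by apply/seteqP; split=> [v Vv|_ [v Vv <-]]; rewrite ?add0r//; exists v; rewrite ?add0r.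
apply: ge_inf; first by exists 0 => l [/ltW].
split; first by rewrite invr_gt0.
apply/(reflection_containment (w := 0) K oP); rewrite ?invr_gt0 ?invrK//.
by move=> x; rewrite add0r.
Qed.

(** A small enough [m] shrinks the reflected body into a ball inside [K]. This keeps the set
    defining the containment factor nonempty, so that its infimum can be approached. *)
Lemma exists_selfmap K P : convex_body K -> exists2 m, 0 < m & selfmap K P m.
Proof.
case=> coK _ [x0 /nbhs_ballP[r /= r0 rK]].
have [M M0 KM] : exists2 M : R, 0 < M & forall y, K y -> `|y *m reflmx P| <= M.
  have /compact_normP[M M0 KM] : compact ((fun y => y *m reflmx P) @` K).
    apply: continuous_compact => //; apply: continuous_subspaceT.
    by apply: continuous_mulmx => x; [exact: cvg_id | exact: cst_continuous].
  by exists M => // y Ky; apply: KM; exists y.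
exists (r / 2 / M); first by rewrite !divr_gt0.
exists x0 => y /KM yM; apply: rK; rewrite -ball_normE /=.
rewrite opprD addrA subrr add0r normrN normrZ ger0_norm; last by rewrite !divr_ge0 ?ltW.
apply: (@le_lt_trans _ _ (r / 2)).
  by rewrite -[leRHS](divfK (lt0r_neq0 M0)) ler_wpM2l// !divr_ge0// ltW.
by rewrite ltr_pdivrMr// ltr_pMr// ltr1n.
Qed.

Lemma chirality_lt j K l : (j <= n)%N -> convex_body K -> chirality j K < l ->
  exists P m, [/\ orthoproj j P, 0 < m, selfmap K P m & m^-1 < l].
Proof.
move=> jn bK Kl.
have [|_ [U aU <-]] := inf_lt _ Kl.
  have [U aU] := exists_affine_subspace jn.
  by exists (containment_factor K (reflection U @` K)), U.
have [P [w [oP rU]]] := reflection_affine aU.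
move=> Ul; have [|l' [l'0 Kl'] l'l] := inf_lt _ Ul.
  have [m m0 Km] := exists_selfmap P bK.
  exists m^-1; split; first by rewrite invr_gt0.
  by apply/(reflection_containment K oP rU); rewrite ?invr_gt0 ?invrK.
exists P, l'^-1; split; rewrite ?invr_gt0 ?invrK//.
exact/(reflection_containment K oP rU l'0).
Qed.


End Reflections.

(** * Compactness of the admissible triples and attainment of the infimum *)

Section Attainment.
Variables (R : realType) (n j : nat).
Implicit Types (P : 'M[R]_n) (x y z u v w : 'rV[R]_n).

Lemma closed_eq_continuous (T : topologicalType) (V : normedModType R)
  (f g : T -> V) : continuous f -> continuous g -> closed [set t | f t = g t].
Proof.
move=> fc gc.
have -> : [set t | f t = g t] = (fun t => f t - g t) @^-1` [set 0].
  apply/seteqP; split=> t /=; first by move=> ->; rewrite subrr.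
  by move/eqP; rewrite subr_eq0 => /eqP.
apply: preimage_closed.
  by move=> t _; apply: continuousB; [exact: fc | exact: gc].
exact: (compact_closed (@norm_hausdorff _ V) (@compact_set1 _ _)).
Qed.

(** The matrix is symmetric and squares to the identity, hence is orthogonal. *)
Lemma reflmx_isometry P u : @orthoproj R n j P ->
  dotv (u *m reflmx P) (u *m reflmx P) = dotv u u.
Proof.
move=> oP; rewrite !dotvE trmx_mul.
have -> : (reflmx P)^T = reflmx P.
  by case: oP => PT _ _; rewrite /reflmx linearB linearZ /= PT trmx1.
by rewrite mulmxA -(mulmxA u) (reflmxK oP) mulmx1.
Qed.

Lemma closed_orthoproj : closed (@orthoproj R n j).
Proof.
have -> : @orthoproj R n j = [set P | P^T = P] `&`
    ([set P | P *m P = P] `&` [set P | \tr P = j%:R :> R^o]).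
  by apply/seteqP; split=> P; [case | case=> ? []].
have cid : continuous (fun P : 'M[R]_n => P) by move=> P; exact: cvg_id.
apply: closedI; last apply: closedI; apply: closed_eq_continuous => //.
- apply: continuous_mx => i k.
  rewrite (_ : (fun P => _) = fun P : 'M[R]_n => P k i); first exact: continuous_entry.
  by apply/funext => P; rewrite mxE.
- exact: continuous_mulmx.
- apply: continuous_big; first exact: add_continuous.
  by move=> i _; exact: continuous_entry.
- by move=> x; exact: cst_continuous.
Qed.

(** Comparing diagonals in [P = P P^T], each [P i i] is the sum of the squares in row [i]. So
    [(P i i)^2 <= P i i], whence [P i i <= 1], and this bounds every square in the row. *)
Lemma orthoproj_entry P i k : @orthoproj R n j P -> `|P i k| <= 1.
Proof.
case=> PT PP _.
have diag : P i i = \sum_l P i l ^+ 2.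
  rewrite -{1}PP mxE; apply: eq_bigr => l _; rewrite expr2; congr (_ * _).
  by rewrite -{1}PT mxE.
have le_diag l : P i l ^+ 2 <= P i i.
  by rewrite diag (bigD1 l)//= lerDl sumr_ge0// => ? _; exact: sqr_ge0.
have d0 : 0 <= P i i by rewrite diag sumr_ge0// => ? _; exact: sqr_ge0.
have d1 : P i i <= 1.
  have [//|d1] := leP (P i i) 1.
  have := le_diag i; rewrite expr2 -subr_ge0 -{1}[P i i]mulr1 -mulrBr.
  by rewrite pmulr_rge0 ?(lt_trans ltr01 d1)// subr_ge0 leNgt d1.
rewrite -(@ler_pXn2r _ 2) ?nnegrE// expr1n real_normK ?num_real//.
exact: le_trans (le_diag k) d1.
Qed.

Lemma compact_orthoproj : compact (@orthoproj R n j).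
Proof.
apply: (subclosed_compact closed_orthoproj (@compact_mx_box R n n 1)).
by move=> P oP i k; exact: orthoproj_entry.
Qed.

(** Recentring at a fixed point replaces the translation [z] by a point of the compact set [K]; this
    point becomes the centre in the theorem. *)
Lemma selfmap_fixpoint (K : set 'rV[R]_n) P m : convex_body K -> selfmap K P m ->
  exists2 x, K x & forall y, K y -> K (x + m *: ((y - x) *m reflmx P)).
Proof.
move=> [coK cK [x0 /interior_subset Kx0]] [z Kz].
have [||x Kx xE] := @affine_fixpoint R n K z (m *: reflmx P) coK cK.
- by exists x0.
- by move=> y /Kz; rewrite scalemxAr.
exists x => // y /Kz; congr K.
rewrite {1}xE; move: (reflmx P) => A.
by rewrite mulmxBl scalerBr !scalemxAr [RHS]addrC [z + x *m _]addrC addrA subrK addrC.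
Qed.

Lemma norm_entry u i : `|u 0 i| <= `|u|.
Proof.
have /mapP[k _ ->] : `|u 0 i| \in [seq `|u x.1 x.2| | x : 'I_1 * 'I_n].
  by apply/mapP; exists (0, i); rewrite ?mem_enum.
by rewrite [leRHS]/Num.norm /= mx_normrE; apply/bigmax_geP; right => /=; exists k.
Qed.

Lemma dotv_le_norm u : dotv u u <= n%:R * `|u| ^+ 2.
Proof.
rewrite -[n in n%:R]card_ord mulr_natl -sumr_const; apply: ler_sum => i _.
by rewrite -expr2 -real_normK ?num_real// lerXn2r ?nnegrE// norm_entry.
Qed.

Lemma convex_body_neq (K : set 'rV[R]_n) (i : 'I_n) : convex_body K ->
  exists x y, [/\ K x, K y & y - x != 0].
Proof.
case=> _ _ [x /[dup] /interior_subset Kx /nbhs_ballP[r /= r0 rK]].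
pose v : 'rV[R]_n := const_mx 1.
have v0 : v != 0.
  by apply/eqP => /rowP/(_ i); rewrite !mxE => /eqP; rewrite oner_eq0.
pose w := (r / 2 / `|v|) *: v.
have w0 : w != 0 by rewrite scaler_eq0 negb_or v0 andbT gt_eqF ?divr_gt0 ?normr_gt0.
exists x, (x + w); split=> //; last by rewrite addrC addKr.
apply: rK; rewrite -ball_normE /= opprD addrA subrr add0r normrN normrZ.
rewrite normrM normfV normr_id divfK ?normr_eq0// gtr0_norm ?divr_gt0//.
by rewrite ltr_pdivrMr// ltr_pMr// ltr1n.
Qed.

(** The self-map multiplies the Euclidean distance of two distinct points of [K] by [m], and the
    images stay in the bounded set [K]. *)
Lemma selfmap_bound (K : set 'rV[R]_n) : (0 < n)%N -> convex_body K ->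
  exists B : R, forall P m, @orthoproj R n j P -> selfmap K P m -> m <= B.
Proof.
move=> n0 bK; have [x [y [Kx Ky yx0]]] := convex_body_neq (Ordinal n0) bK.
have [M M0 KM] : exists2 M : R, 0 < M & forall x, K x -> `|x| <= M.
  by case: bK => /compact_normP.
pose v := y - x; pose c := dotv v v.
have c0 : 0 < c.
  rewrite lt_neqAle eq_sym; apply/andP; split.
    by apply: contraNneq yx0 => /dotvv_eq0/eqP.
  by apply: sumr_ge0 => i _; rewrite -expr2 sqr_ge0.
pose D := n%:R * (M + M) ^+ 2.
(* From [m^2 <= D / c] follows [m <= D / c] when [m > 1]; the summand 1 covers [m <= 1]. *)
exists (D / c + 1) => P m oP [z Kz].
have : m ^+ 2 * c <= D.
  have <- : dotv (m *: (v *m reflmx P)) (m *: (v *m reflmx P)) = m ^+ 2 * c.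
    rewrite /c -(reflmx_isometry v oP) !dotvE linearZ /= -scalemxAl -scalemxAr.
    by rewrite scalerA -expr2 mxE.
  have -> : m *: (v *m reflmx P) =
      z + m *: (y *m reflmx P) - (z + m *: (x *m reflmx P)).
    move: (reflmx P) => A.
    by rewrite opprD addrACA subrr add0r -scalerBr -mulmxBl.
  apply: le_trans (dotv_le_norm _) _; rewrite ler_wpM2l//.
  rewrite lerXn2r ?nnegrE ?addr_ge0 ?(ltW M0)//.
  by rewrite (le_trans (ler_normB _ _))// lerD// KM//; exact: Kz.
rewrite -ler_pdivlMr// => mD.
have [m1|m1] := leP m 1.
  by rewrite (le_trans m1)// lerDr divr_ge0 ?(ltW c0)// mulr_ge0// sqr_ge0.
apply: (@le_trans _ _ (m ^+ 2)); first by rewrite expr2 ler_peMl// ?ltW// (lt_trans ltr01).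
by rewrite (le_trans mD)// lerDl.
Qed.

Lemma chirality_attained (K : set 'rV[R]_n) : (0 < n)%N -> (j <= n)%N ->
  convex_body K -> exists P x m, [/\ @orthoproj R n j P, K x, 0 < m,
    chirality j K = m^-1 & forall y, K y -> K (x + m *: ((y - x) *m reflmx P))].
Proof.
move=> n0 jn bK; have [B mB] := selfmap_bound n0 bK.
have [coK cK _] := bK.
have clK : closed K := compact_closed (@norm_hausdorff _ _) coK.
pose f y (q : 'M[R]_n * ('rV[R]_n * R)) : 'rV[R]_n :=
  q.2.1 + q.2.2 *: ((y - q.2.1) *m reflmx q.1).
have fc y : continuous (f y).
  pose T := ('M[R]_n * ('rV[R]_n * R))%type.
  have c1 : continuous (fun q : T => q.2.1).
    move=> q; apply: (continuous_comp (f := snd) (g := fst)).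
      exact: cvg_snd.
    exact: cvg_fst.
  have c2 : continuous (fun q : T => q.2.2).
    by move=> q; apply: (continuous_comp (f := snd) (g := snd)); exact: cvg_snd.
  have c3 : continuous (fun q : T => reflmx q.1).
    move=> q; apply: (@continuousB R 'M[R]_n T (fun q => 2 *: q.1) (fun=> 1%:M));
      last exact: cst_continuous.
    by apply: continuousZ; [exact: cst_continuous | exact: cvg_fst].
  move=> q; apply: (@continuousD R 'rV[R]_n T (fun q => q.2.1)
    (fun q => q.2.2 *: ((y - q.2.1) *m reflmx q.1))); first exact: c1.
  apply: continuousZ; first exact: c2.
  apply: continuous_mulmx => // {}q.
  apply: (@continuousB R 'rV[R]_n T (fun=> y) (fun q => q.2.1)); last exact: c1.
  exact: cst_continuous.
(* The admissible triples [(P, x, m)]: a compact product cut by the closed conditions that [y] is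
   sent into [K], one for each [y] in [K]. *)
pose S := (@orthoproj R n j `*` (K `*` `[0, B]%classic)) `&`
  \bigcap_(y in K) (f y @^-1` K).
have coS : compact S.
  apply: compact_closedI.
    apply: compact_setX; first exact: compact_orthoproj.
    by apply: compact_setX => //; exact: segment_compact.
  apply: closed_bigI => y _; apply: preimage_closed => // q _; exact: fc.
have SI P m : orthoproj j P -> 0 < m -> selfmap K P m ->
    exists x, S (P, (x, m)).
  move=> oP m0 sK; have [x Kx Kf] := selfmap_fixpoint bK sK.
  exists x; split=> //; split=> //; split=> //=.
  by rewrite in_itv/= ltW//= (mB P).
have [P0 [m0 [oP0 m00 sK0 _]]] : exists P m,
    [/\ @orthoproj R n j P, 0 < m, selfmap K P m & m^-1 < chirality j K + 1].
  by apply: chirality_lt => //; rewrite ltrDl.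
have [x0 S0] := SI _ _ oP0 m00 sK0.
have [[P [x m]] qS mmax] : exists2 q, q \in S & forall t, t \in S -> t.2.2 <= q.2.2.
  apply: compact_EVT_max coS _; first by exists (P0, (x0, m0)).
  apply: continuous_subspaceT => q.
  by apply: continuous_comp; [exact: cvg_snd | exact: cvg_snd].
have [[oP [/= Kx _]] Kf] := set_mem qS.
(* [S] allows [m = 0]; the maximal [m] is positive since it dominates the positive [m0] found
   above. *)
have m_gt0 : 0 < m by apply: lt_le_trans (mmax (P0, (x0, m0)) (mem_set S0)).
exists P, x, m; split=> //.
apply/le_anti/andP; split.
  apply: chirality_le oP m_gt0 _; exists (x - m *: (x *m reflmx P)) => y Ky.
  have := Kf y Ky; rewrite /f /=; congr K; move: (reflmx P) => A.
  by rewrite mulmxBl scalerBr addrCA addrC.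
(* A pair with [1/m1] within [e] of the chirality also yields a point of [S], so [m1 <= m]. *)
apply/ler_addgt0Pr => e e0.
have [P1 [m1 [oP1 m10 sK1 m1e]]] : exists P m,
    [/\ @orthoproj R n j P, 0 < m, selfmap K P m & m^-1 < chirality j K + e].
  by apply: chirality_lt => //; rewrite ltrDl.
have [x1 S1] := SI _ _ oP1 m10 sK1.
apply: le_trans (ltW m1e); rewrite lef_pV2 ?posrE//.
exact: (mmax (P1, (x1, m1)) (mem_set S1)).
Qed.

End Attainment.

(** * Continuity with respect to the Hausdorff distance *)

Section Continuity.
Variables (R : realType) (n : nat).
Implicit Types (K L : set 'rV[R]_n) (P : 'M[R]_n) (x y z u v w : 'rV[R]_n).

(** Lets Euclidean perturbations be treated as sup-norm ones, so that later estimates can use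
    sup-norm balls throughout. *)
Lemma eball_norm u : @eball R n u -> `|u| <= 1.
Proof.
rewrite /eball /= /enorm => u1.
have uu0 : 0 <= dotv u u by apply: sumr_ge0 => i _; rewrite -expr2 sqr_ge0.
have uu1 : dotv u u <= 1.
  by rewrite -(sqr_sqrtr uu0) -(expr1n R 2) lerXn2r ?nnegrE ?sqrtr_ge0.
rewrite [leLHS]/Num.norm /= mx_normrE; apply/bigmax_leP; split=> //= -[i k] _ /=.
rewrite ord1 -(@ler_pXn2r _ 2) ?nnegrE// expr1n real_normK ?num_real//.
apply: le_trans uu1; rewrite /dotv (bigD1 k)//= -expr2 lerDl.
by apply: sumr_ge0 => l _; rewrite -expr2 sqr_ge0.
Qed.

Lemma norm_eball u : n%:R * `|u| ^+ 2 <= 1 -> @eball R n u.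
Proof.
move=> u1; rewrite /eball /= /enorm -[leRHS]sqrtr1 ler_sqrt//.
exact: le_trans (dotv_le_norm _) u1.
Qed.

Lemma hausdorff_dist_lt K L d : compact K -> compact L -> K !=set0 -> L !=set0 ->
  hausdorff_dist K L < d -> exists l, [/\ 0 < l, l < d,
    forall x, K x -> exists y b, [/\ L y, `|b| <= 1 & x = y + l *: b] &
    forall x, L x -> exists y b, [/\ K y, `|b| <= 1 & x = y + l *: b]].
Proof.
move=> /compact_normP[M1 M10 KM] /compact_normP[M2 M20 LM] [k0 Kk0] [l0 Ll0].
move=> KLd.
have M0 : 0 < M1 + M2 by rewrite addr_gt0.
(* An admissible radius, showing that the set under the infimum is nonempty. The factor [n+1] passes
   from the sup norm to the Euclidean norm, via [n <= (n+1)^2], and is positive also for [n = 0]. *)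
pose D := (M1 + M2) * n.+1%:R.
have D0 : 0 < D by rewrite mulr_gt0.
have sub x y : `|x - y| <= M1 + M2 ->
    x = y + D *: (D^-1 *: (x - y)) /\ eball (D^-1 *: (x - y)).
  move=> xy; split; first by rewrite scalerA divff ?gt_eqF// scale1r addrC subrK.
  apply: norm_eball; rewrite normrZ gtr0_norm ?invr_gt0// exprMn.
  have xyD : D^-1 * `|x - y| <= n.+1%:R^-1.
    by rewrite /D invfM mulrAC ler_piMl// mulrC ler_pdivrMr ?mul1r.
  rewrite -exprMn; apply: (@le_trans _ _ (n%:R * n.+1%:R^-1 ^+ 2)).
    by rewrite ler_wpM2l// lerXn2r ?nnegrE// mulr_ge0// invr_ge0 ltW.
  rewrite exprVn ler_pdivrMr ?exprn_gt0// mul1r expr2 -natrM ler_nat.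
  by rewrite (leq_trans (leqnSn n))// leq_pmulr.
have [|l [lgt0 Kl Ll] ld] := inf_lt _ KLd.
  exists D; split=> // x.
    move=> Kx; have [|xE b1] := sub x l0.
      by rewrite (le_trans (ler_normB _ _))// lerD ?KM ?LM.
    by exists l0 => //; exists (D^-1 *: (x - l0)).
  move=> Lx; have [|xE b1] := sub x k0.
    by rewrite (le_trans (ler_normB _ _))// addrC lerD ?KM ?LM.
  by exists k0 => //; exists (D^-1 *: (x - k0)).
exists l; split=> // x.
  by move=> /Kl[y Ly [b /eball_norm b1 <-]]; exists y, b.
by move=> /Ll[y Ly [b /eball_norm b1 <-]]; exists y, b.
Qed.

(** Composing [L -> K -> K -> L] multiplies the linear parts; homotheties commute with the
    reflection. *)
Lemma selfmap_transfer K L P m a b s s' : selfmap K P m ->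
  (forall y, L y -> K (a + s *: y)) -> (forall y, K y -> L (b + s' *: y)) ->
  selfmap L P (s' * m * s).
Proof.
move=> [z Kz] LK KL; exists (b + s' *: (z + m *: (a *m reflmx P))) => y Ly.
have := KL _ (Kz _ (LK y Ly)); congr L; move: (reflmx P) => A.
by rewrite mulmxDl -scalemxAl !scalerDr !scalerA !addrA.
Qed.

Lemma chirality_transfer j K L a b s s' : (j <= n)%N -> convex_body K ->
  0 < s -> 0 < s' ->
  (forall y, L y -> K (a + s *: y)) -> (forall y, K y -> L (b + s' *: y)) ->
  s' * s * chirality j L <= chirality j K.
Proof.
move=> jn bK s0 s'0 LK KL; apply/ler_addgt0Pr => e e0.
have [P [m [oP m0 sK me]]] : exists P m,
    [/\ @orthoproj R n j P, 0 < m, selfmap K P m & m^-1 < chirality j K + e].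
  by apply: chirality_lt => //; rewrite ltrDl.
apply: le_trans (ltW me).
have := chirality_le oP _ (selfmap_transfer sK LK KL).
rewrite !mulr_gt0// => /(_ isT); rewrite -ler_pdivlMl ?mulr_gt0//.
by move/le_trans; apply; rewrite !invfM; lra.
Qed.

Lemma convex_body_ball K : convex_body K ->
  exists x0 r, 0 < r /\ forall b, `|b| <= 1 -> K (x0 + r *: b).
Proof.
case=> _ _ [x0 /nbhs_ballP[r /= r0 rK]].
(* Halving the radius turns the open ball into a closed one. *)
exists x0, (r / 2); split; first by rewrite divr_gt0.
move=> b b1; apply: rK; rewrite -ball_normE /= opprD addrA subrr add0r normrN.
rewrite normrZ gtr0_norm ?divr_gt0//; apply: (@le_lt_trans _ _ (r / 2)).
  by rewrite ler_piMr// divr_ge0// ltW.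
by rewrite ltr_pdivrMr// ltr_pMr// ltr1n.
Qed.

(** The perturbation [l b] equals [t (c - x0)] with [c = x0 + r b] in [K]. For [y = k + t (c - x0)]
    in [L], the contracted point is the convex combination [(k + t c) / (1 + t)]. The other
    inclusion comes from [set_cancel]. *)
Lemma close_sandwich K L x0 r l : convex_body K -> convex_body L ->
  (forall b, `|b| <= 1 -> K (x0 + r *: b)) -> 0 < l < r ->
  (forall x, K x -> exists y b, [/\ L y, `|b| <= 1 & x = y + l *: b]) ->
  (forall x, L x -> exists y b, [/\ K y, `|b| <= 1 & x = y + l *: b]) ->
  let t := l / r in
  (forall y, L y -> K (x0 + (1 + t)^-1 *: (y - x0))) /\
  (forall y, K y -> L (x0 + (1 - t) *: (y - x0))).
Proof.
move=> [coK cK _] [coL cL _] Kr /andP[l0 lr] KL LK t.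
have r0 : 0 < r := lt_trans l0 lr.
have t0 : 0 < t by rewrite divr_gt0.
have t1 : t < 1 by rewrite ltr_pdivrMr// mul1r.
have lb b : l *: b = t *: ((x0 + r *: b) - x0).
  by rewrite [x0 + _]addrC addrK scalerA /t divfK ?gt_eqF.
split=> y.
  move=> /LK[k [b [Kk b1 ->]]].
  have t1n : 1 + t != 0 by rewrite gt_eqF ?addr_gt0.
  have := @convex_setE _ _ K k (x0 + r *: b) (1 + t)^-1 cK _ Kk (Kr b b1).
  rewrite invr_ge0 addr_ge0 ?(ltW t0)//= invf_le1 ?addr_gt0// lerDl (ltW t0).
  move=> /(_ isT); congr K; rewrite lb; move: (x0 + r *: b) => c.
  apply/rowP => i; rewrite !mxE; field.
  by [].
move=> Ky; have clL : closed L := compact_closed (@norm_hausdorff _ _) coL.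
(* The cancelled set is [t K]: for [c] in [K], the point [t c + (1 - t) y] of [K] is
   [p + t (c' - x0)] with [p] in [L] and [c'] in [K]. Hence the target point plus [t c] equals
   [p + t c']. *)
apply: (set_cancel (C := (fun c => t *: c) @` K) clL cL).
- apply: continuous_compact => //; apply: continuous_subspaceT => c.
  apply: (@continuousZ R 'rV[R]_n _ (fun=> t) id); last exact: cvg_id.
  exact: cst_continuous.
- by exists (t *: y), y.
move=> _ [c Kc <-].
have /KL[p [b [Lp b1 E]]] : K (t *: c + (1 - t) *: y).
  by apply: convex_setE => //; rewrite !ltW.
exists p, (t *: (x0 + r *: b)); split=> //;
  first by exists (x0 + r *: b) => //; exact: Kr.
have -> : p = t *: c + (1 - t) *: y - t *: ((x0 + r *: b) - x0) by rewrite E lb addrK.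
move: (x0 + r *: b) => c'; apply/rowP => i; rewrite !mxE; ring.
Qed.

Lemma chirality_continuous j K : (j <= n)%N -> convex_body K ->
  forall e : R, 0 < e -> exists d : R, 0 < d /\
    forall L, convex_body L -> hausdorff_dist K L < d ->
      `|chirality j L - chirality j K| < e.
Proof.
move=> jn bK e e0; have [x0 [r [r0 Kr]]] := convex_body_ball bK.
set A := chirality j K; have A0 : 0 <= A := chirality_ge0 j K.
(* With [B] the chirality of [L], both [(1 - 2t) B <= A] and [(1 - 2t) A <= B] will hold. For
   [t < 1/4] these give a difference of at most [4 t A], which the second bound keeps below [e];
   [A + 1] avoids division by 0. *)
pose t0 := Num.min (4^-1) (e / (4 * (A + 1))).
have A1 : 0 < 4 * (A + 1) by rewrite mulr_gt0// ltr_wpDl.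
have t00 : 0 < t0 by rewrite lt_min invr_gt0 ltr0n divr_gt0.
exists (t0 * r); split; first by rewrite mulr_gt0.
move=> L bL KLd.
have [coK cK [xK /interior_subset KxK]] := bK.
have [coL cL [xL /interior_subset LxL]] := bL.
have [|| l [l0 ld KL LK]] := hausdorff_dist_lt coK coL _ _ KLd.
- by exists xK.
- by exists xL.
have lr : l < r.
  apply: (lt_le_trans ld); rewrite ger_pMl// ge_min.
  by rewrite invf_le1 ?ler1n.
have := close_sandwich bK bL Kr _ KL LK; rewrite l0 lr => /(_ isT) /=.
set t := l / r => -[LK' KL'].
have tpos : 0 < t by rewrite divr_gt0.
have : t < t0 by rewrite ltr_pdivrMr.
rewrite lt_min => /andP[t4]; rewrite ltr_pdivlMr// => te.
have t1n : 1 + t != 0 by rewrite gt_eqF ?addr_gt0.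
have s0 : 0 < (1 + t)^-1 by rewrite invr_gt0 addr_gt0.
have s'0 : 0 < 1 - t by rewrite subr_gt0 (lt_trans t4)// invf_lt1 ?ltr1n.
set s := (1 + t)^-1 in s0 LK'; have st : s * (1 + t) = 1 by rewrite mulVf.
have KLA : (1 - t) * s * chirality j L <= A.
  apply: (chirality_transfer (a := x0 - s *: x0) (b := x0 - (1 - t) *: x0) jn bK) => // y.
    by move=> /LK'; rewrite scalerBr addrAC addrA.
  by move=> /KL'; rewrite scalerBr addrAC addrA.
have LKA : s * (1 - t) * A <= chirality j L.
  apply: (chirality_transfer (a := x0 - (1 - t) *: x0) (b := x0 - s *: x0) jn bL) => // y.
    by move=> /KL'; rewrite scalerBr addrAC addrA.
  by move=> /LK'; rewrite scalerBr addrAC addrA.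
have B0 : 0 <= chirality j L := chirality_ge0 j L.
move: (chirality j L) B0 KLA LKA => B B0 KLA LKA.
have rho : 1 - 2 * t <= (1 - t) * s by nra.
have H1 : (1 - 2 * t) * B <= A by apply: le_trans KLA; rewrite ler_wpM2r.
have H2 : (1 - 2 * t) * A <= B by apply: le_trans LKA; rewrite [s * _]mulrC ler_wpM2r.
rewrite ltr_norml; apply/andP; split; nra.
Qed.

End Continuity.

Theorem proposition3p4 (R : realType) (n j : nat) (hj : (j <= n)%N) :
  (forall K : set 'rV[R]_n, convex_body K ->
     exists (U : {vspace 'rV[R]_n}) (x : 'rV[R]_n),
       [/\ \dim U = j, K x &
           [set y - x | y in K] `<=`
             [set chirality j K *: reflection [set` U] y
                | y in [set y - x | y in K]]]) /\
  (forall K : set 'rV[R]_n, convex_body K ->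
     forall e : R, 0 < e ->
       exists d : R, 0 < d /\
         forall L : set 'rV[R]_n, convex_body L ->
           hausdorff_dist K L < d -> `|chirality j L - chirality j K| < e).
Proof.
split=> K bK; last exact: chirality_continuous.
(* In dimension zero every positive [m] is admissible and no maximum exists; the inclusion then
   holds because the space is a single point. *)
have [n0|n_gt0] := posnP n.
  move: hj K bK; rewrite {}n0 leqn0 => /eqP -> K [_ _ [x /interior_subset Kx]].
  exists 0%VS, x; split=> //; first by rewrite dimv0.
  by move=> y _; exists (x - x); [exists x | apply/rowP => -[]].
have [P [x [m [oP Kx m0 -> Km]]]] := chirality_attained n_gt0 hj bK.
have [U [dimU rU]] := orthoproj_subspace oP.
exists U, x; split=> // _ [y Ky <-].
(* The self-map puts this vector in [K - x]; reflecting it and dividing by [m] returns [y - x], as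
   the reflection is an involution. *)
exists (m *: ((y - x) *m reflmx P)).
  by exists (x + m *: ((y - x) *m reflmx P)); [exact: Km | rewrite addrC addKr].
rewrite rU -scalemxAl scalerA mulVf ?gt_eqF// scale1r -mulmxA.
by rewrite (reflmxK oP) mulmx1.
Qed.
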